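(* Let $\Theta=(\Theta_1,\dots,\Theta_N)$ be an $N$-tuple of pairwise commuting symmetric positive definite $n\times n$ matrices and let $X=(X_t)_{t\in\mathbb{Z}^N}$ be an $\mathbb{R}^n$-valued field. Suppose (i) for every $j\in\{1,\dots,N\}$ and all $t_1,\dots,t_{j-1},t_{j+1},\dots,t_N\in\mathbb{Z}$, $e^{m\Theta_j}X_{t_1,\dots,t_{j-1},m,t_{j+1},\dots,t_N}\to0$ in probability as $m\to-\infty$; (ii) there is $G\in\mathcal{G}_\Theta$ such that $$X_t=\sum_{i\in\{0,1\}^N,\,i\ne\mathbf 0}(-1)^{1+i_1+\dots+i_N}e^{-i\ast\Theta}X_{t_1-i_1,\dots,t_N-i_N}+\Delta_tG,\qquad t\in\mathbb{Z}^N.$$ Then $X$ is stationary and $X=(\mathcal{L}^{-1}_\Theta\circ\mathcal{M}^{-1}_\Theta)(G)$, i.e. $X_t=e^{-t\ast\Theta}\sum_{j=-\infty}^te^{j\ast\Theta}\Delta_jG$ for all $t$.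
   Context: $t\ast\Theta=\sum_{j=1}^N t_j\Theta_j$. Equality in law of fields means equality of all finite-dimensional distributions. $X$ is stationary if $(X_{t+s})_t$ and $(X_t)_t$ are equal in law for every $s\in\mathbb{Z}^N$. For a field $Z=(Z_t)_{t\in\mathbb{Z}^N}$, $\Delta_t Z=\sum_{i\in\{0,1\}^N}(-1)^{i_1+\dots+i_N}Z_{t_1-i_1,\dots,t_N-i_N}$. $G$ is a stationary increment field if $(\Delta_{t+s}G)_{t}$ and $(\Delta_tG)_{t}$ are equal in law for every $s$. $\mathcal{G}_\Theta$ is the class of stationary increment fields $G$ such that $\sum_{j=-\infty}^te^{j\ast\Theta}\Delta_jG:=\lim_{M_1\to\infty}\cdots\lim_{M_N\to\infty}\sum_{j_1=-M_1}^{t_1}\cdots\sum_{j_N=-M_N}^{t_N}e^{j\ast\Theta}\Delta_jG$ converges in probability for every $t$. $(\mathcal{M}^{-1}_\Theta G)_{e^t}=\sum_{j=-\infty}^te^{j\ast\Theta}\Delta_jG$ and $(\mathcal{L}^{-1}_\Theta Y)_t=e^{-t\ast\Theta}Y_{e^t}$. *)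

(* Defs.v *)
From HB Require Import structures.
From mathcomp Require Import all_boot all_order all_algebra.
From mathcomp Require Import all_classical all_reals all_analysis.
Set Implicit Arguments. Unset Strict Implicit. Unset Printing Implicit Defensive.
Import Order.TTheory GRing.Theory Num.Theory.
Import numFieldNormedType.Exports.
Local Open Scope classical_set_scope.
Local Open Scope ring_scope.

Definition mexp {R : realType} {n : nat} (A : 'M[R]_n) : 'M[R]_n :=
  limn (series (fun k : nat => (k`!%:R)^-1 *: A ^+ k)).

Definition idx (N : nat) := 'I_N -> int.

Definition tstar {R : realType} {N n : nat} (t : idx N) (Th : 'I_N -> 'M[R]_n)
  : 'M[R]_n := \sum_(j < N) (t j)%:~R *: Th j.

Definition setc {N : nat} (t : idx N) (j : 'I_N) (m : int) : idx N :=
  fun l => if l == j then m else t l.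

Definition subi {N : nat} (t : idx N) (i : {ffun 'I_N -> bool}) : idx N :=
  fun l => t l - (nat_of_bool (i l))%:Z.

Definition boolidx {N : nat} (i : {ffun 'I_N -> bool}) : idx N :=
  fun l => (nat_of_bool (i l))%:Z.

Definition bsize {N : nat} (i : {ffun 'I_N -> bool}) : nat :=
  \sum_(l < N) nat_of_bool (i l).

Section Fields.
Context {d : measure_display} {Omega : measurableType d} {R : realType}.

Definition rvec (n : nat) := Omega -> 'cV[R]_n.
Definition is_rvec {n : nat} (Y : rvec n) : Prop :=
  forall (i : 'I_n) (j : 'I_1), measurable_fun setT (fun w => Y w i j).

Definition rfield (N n : nat) := idx N -> rvec n.

Definition is_rfield {N n : nat} (X : rfield N n) : Prop :=
  forall t, is_rvec (X t).

Definition borel_mx (n k : nat) : set (set 'M[R]_(n, k)) :=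
  <<s [set A | exists (i : 'I_n) (l : 'I_k) (B : set R),
        measurable B /\ A = [set M : 'M[R]_(n, k) | B (M i l)]] >>.

Definition joint {N n k : nat} (Y : rfield N n) (ts : 'I_k -> idx N)
  : Omega -> 'M[R]_(n, k) := fun w => \matrix_(i < n, l < k) Y (ts l) w i 0.

Definition eq_law (P : probability Omega R) {N n : nat} (Y Z : rfield N n)
  : Prop :=
  forall (k : nat) (ts : 'I_k -> idx N) (A : set 'M[R]_(n, k)),
    borel_mx A ->
    P (joint Y ts @^-1` A) = P (joint Z ts @^-1` A).

Definition shift {N n : nat} (Y : rfield N n) (s : idx N) : rfield N n :=
  fun t => Y (fun l => t l + s l).

Definition stationary (P : probability Omega R) {N n : nat} (Y : rfield N n)
  : Prop := forall s : idx N, eq_law P (shift Y s) Y.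

Definition Delta {N n : nat} (Z : rfield N n) : rfield N n :=
  fun t w => \sum_(i : {ffun 'I_N -> bool}) (-1) ^+ (bsize i) *: Z (subi t i) w.

Definition stat_incr (P : probability Omega R) {N n : nat} (G : rfield N n)
  : Prop := forall s : idx N, eq_law P (shift (Delta G) s) (Delta G).

Definition cvg_prob (P : probability Omega R) {n : nat}
  (Y : nat -> rvec n) (L : rvec n) : Prop :=
  forall eps : R, 0 < eps ->
    (fun m => P [set w | eps <= `| Y m w - L w |]) @ \oo --> 0%E.

(** Iterated limit in probability
      lim_{M_1 -> oo} ... lim_{M_N -> oo} F(M_1, ..., M_N) = L :
    there are random vectors Gs k M (the value after the innermost
    N - k limits have been taken) with Gs N = F and, for each k < N,
    Gs (k+1) (M with M_k := m) --> Gs k M in probability as m -> oo;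
    L is the final (outermost) limit. *)
Definition iter_cvg_prob (P : probability Omega R) {N n : nat}
  (F : ('I_N -> nat) -> rvec n) (L : rvec n) : Prop :=
  exists Gs : nat -> ('I_N -> nat) -> rvec n,
    [/\ Gs N = F,
        forall k M, is_rvec (Gs k M),
        forall (k : 'I_N) (M : 'I_N -> nat),
          cvg_prob P (fun m => Gs k.+1 (fun l => if l == k then m else M l))
                     (Gs k M)
      & L = Gs 0%N (fun _ => 0%N)].

(** partial sums  sum_{j_l = t_l - M_l}^{t_l} e^{j * Theta} Delta_j G *)
Definition psum {N n : nat} (Th : 'I_N -> 'M[R]_n) (G : rfield N n) (t : idx N)
  (M : 'I_N -> nat) : rvec n :=
  fun w => \sum_(i : {ffun 'I_N -> 'I_(\max_(l < N) M l).+1}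
                   | [forall l, (i l <= M l)%N])
     (mexp (tstar (fun l => t l - (i l : nat)%:Z) Th)
       *m Delta G (fun l => t l - (i l : nat)%:Z) w).

Definition GTheta (P : probability Omega R) {N n : nat}
  (Th : 'I_N -> 'M[R]_n) (G : rfield N n) : Prop :=
  is_rfield G /\ stat_incr P G /\
  forall t : idx N, exists L : rvec n, iter_cvg_prob P (psum Th G t) L.

End Fields.

Definition symmetric_pd {R : realType} {n : nat} (A : 'M[R]_n) : Prop :=
  A^T = A /\ forall v : 'cV[R]_n, v != 0 -> 0 < (v^T *m A *m v) 0 0.

(* Main.v *)
Require Import Defs.
From HB Require Import structures.
From mathcomp Require Import all_boot all_order all_algebra.
From mathcomp Require Import all_classical all_reals all_analysis.
From mathcomp Require Import measurable_realfun zify ring lra.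
Set Implicit Arguments.
Unset Strict Implicit.
Unset Printing Implicit Defensive.
Import Order.TTheory GRing.Theory Num.Theory.
Import numFieldNormedType.Exports.
Local Open Scope classical_set_scope.
Local Open Scope ring_scope.

(** Put [Y t = exp(t * Th) X t].  The recursion says that the rectangular
    increments of [Y] are [exp(t * Th) Delta_t G], so the partial sums of the
    series telescope to the alternating sum of [Y] over the corners of a box.
    By the vanishing assumption every inner limit kills the corners that are
    moved in the corresponding coordinate, so the iterated limit is [Y t].
    Along the same chain of limits stationarity is inherited: the partial sums,
    damped by [exp(- t * Th)], are a fixed linear image of translates of
    [Delta G], and a limit in probability of fields equal in law is again a pair
    of fields equal in law. *)

(** * The matrix exponential *)

(** A limit in probability is determined only up to a null set, and an iterated limit need not be a
    joint one. Everything therefore passes through the limits one coordinate at a time, from the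
    last coordinate to the first, and the random vectors supplied by [iter_cvg_prob] are identified
    almost surely only. The boxes in [psum] are anchored at [t] and their side lengths do not depend
    on [t]. After damping, the weights depend only on the offset from [t], so the truncated sums are
    stationary for each fixed [M], not merely in the limit. Laws are compared on finite
    intersections of open half-spaces. Strict inequalities replace the usual choice of continuity
    points: such a set is exhausted by shrunken copies of itself. Commutativity enters through exp(A
    + B) = exp(A) exp(B), which is obtained by dominating the error of the truncated matrix series
    by that of a scalar series. *)

Lemma mx_entry_norm_le (R : realType) (m n : nat) (M : 'M[R]_(m, n)) i j :
  `|M i j| <= `|M|.
Proof.
rewrite [leRHS]/Num.norm /= mx_normrE.
by apply/bigmax_geP; right; exists (i, j).
Qed.

Lemma mx_norm_ltP (R : realType) (m n : nat) (M : 'M[R]_(m, n)) (e : R) :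
  0 < e -> reflect (forall i j, `|M i j| < e) (`|M| < e).
Proof.
move=> e0; apply: (iffP idP) => [Me i j|Me].
  exact: le_lt_trans (mx_entry_norm_le M i j) Me.
by rewrite [ltLHS]/Num.norm /= mx_normrE; apply/bigmax_ltP; split.
Qed.

Lemma cvg_mx_entries (R : realType) (m n : nat) (u : nat -> 'M[R]_(m, n))
    (M : 'M[R]_(m, n)) :
  (forall i j, (fun k => u k i j) @ \oo --> M i j) -> u @ \oo --> M.
Proof.
move=> uM; apply/cvgrPdist_lt => e e0.
have : \forall k \near \oo, forall i j, `|M i j - u k i j| < e.
  apply: filter_forall => i; apply: filter_forall => j.
  by have /cvgrPdist_lt /(_ e e0) := uM i j.
apply: filterS => k ke; apply/(mx_norm_ltP _ e0) => i j.
by rewrite !mxE; exact: ke.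
Qed.

(** The binomial theorem for commuting elements: the truncated series of [x + y] fills only the
    triangle [i + j < m] of the square of products. *)
Lemma exp_partial_sumD (R : realType) (T : algType R) (x y : T) (m : nat) :
  GRing.comm x y ->
  \sum_(k < m) (k`!%:R)^-1 *: (x + y) ^+ k =
  \sum_(i < m) \sum_(j < m | (i + j < m)%N)
    ((i`!%:R)^-1 * (j`!%:R)^-1 : R) *: (x ^+ i * y ^+ j).
Proof.
move=> xy.
have E (k : 'I_m) : (k`!%:R)^-1 *: (x + y) ^+ k =
    \sum_(i < m) \sum_(j < m | (k : nat) == (i + j)%N)
      ((i`!%:R)^-1 * (j`!%:R)^-1 : R) *: (x ^+ i * y ^+ j).
  rewrite addrC exprDn_comm; last exact: commr_sym.
  rewrite scaler_sumr.
  rewrite -(big_mkord xpredT (fun i => k`!%:R^-1 *: (y ^+ (k - i) * x ^+ i *+ 'C(k, i)))).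
  rewrite -(big_mkord xpredT (fun i => \sum_(j < m | (k : nat) == (i + j)%N)
      ((i`!%:R)^-1 * (j`!%:R)^-1 : R) *: (x ^+ i * y ^+ j))).
  rewrite (big_nat_widen _ k.+1 m) //=.
  rewrite [LHS]big_mkcond; apply: eq_big_nat => i /andP[_ im] /=.
  case: ltnP => [ik|ki]; last first.
    by rewrite big_pred0 // => j; apply/eqP => kij; rewrite kij ltnNge leq_addr in ki.
  have kim : (k - i < m)%N by apply: leq_ltn_trans (leq_subr _ _) (ltn_ord k).
  rewrite (big_pred1 (Ordinal kim)) => [|j]; last first.
    rewrite -[RHS]val_eqE /=; apply/eqP/eqP => [->|->]; first by rewrite addKn.
    by rewrite subnKC.
  rewrite /= -[_ *+ 'C(_, _)]scaler_nat.
  rewrite scalerA.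
  have -> : y ^+ (k - i) * x ^+ i = x ^+ i * y ^+ (k - i).
    by apply: commrX; apply/commr_sym; apply: commrX.
  congr (_ *: _).
  have := bin_fact (ltnSE ik) => /(congr1 (fun n => n%:R : R)).
  rewrite !natrM => <-.
  have f0 n : (n`!%:R : R) != 0 by rewrite pnatr_eq0 -lt0n fact_gt0.
  have b0 : ('C(k, i)%:R : R) != 0 by rewrite pnatr_eq0 -lt0n bin_gt0.
  by rewrite !invfM mulrAC mulVf// mul1r.
rewrite (eq_bigr _ (fun k _ => E k)) exchange_big; apply: eq_bigr => i _ /=.
rewrite (exchange_big_dep (fun j : 'I_m => (i + j < m)%N)) => [|k j _ /eqP <-]//.
apply: eq_bigr => j ijm; by rewrite (big_pred1 (Ordinal ijm)).
Qed.

(** What the product of truncations has in excess is the other half of the square, with nonnegative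
    coefficients. Stating this for any algebra lets the matrix defect be compared with the scalar
    one. *)
Lemma exp_partial_sum_defect (R : realType) (T : algType R) (x y : T) (m : nat) :
  GRing.comm x y ->
  (\sum_(k < m) (k`!%:R)^-1 *: x ^+ k) * (\sum_(k < m) (k`!%:R)^-1 *: y ^+ k)
   - \sum_(k < m) (k`!%:R)^-1 *: (x + y) ^+ k =
  \sum_(i < m) \sum_(j < m | ~~ (i + j < m)%N)
    ((i`!%:R)^-1 * (j`!%:R)^-1 : R) *: (x ^+ i * y ^+ j).
Proof.
move=> xy; rewrite exp_partial_sumD// mulr_suml -sumrB.
apply: eq_bigr => i _; rewrite mulr_sumr.
rewrite [X in X - _](bigID (fun j : 'I_m => (i + j < m)%N)) /=.
rewrite addrAC (eq_bigr (fun j : 'I_m =>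
  ((i`!%:R)^-1 * (j`!%:R)^-1 : R) *: (x ^+ i * y ^+ j))); last first.
  by move=> j _; rewrite -scalerAl -scalerAr scalerA.
rewrite subrr add0r; apply: eq_bigr => j _.
by rewrite -scalerAl -scalerAr scalerA.
Qed.

(** The norm of a matrix is its largest absolute entry, which is not submultiplicative; this sum
    controls the entries of products and powers. *)
Definition mx_abs_sum {R : realType} {m n : nat} (A : 'M[R]_(m, n)) : R :=
  \sum_i \sum_j `|A i j|.

Lemma mx_abs_sum_ge0 (R : realType) (m n : nat) (A : 'M[R]_(m, n)) :
  0 <= mx_abs_sum A.
Proof. by apply: sumr_ge0 => i _; apply: sumr_ge0. Qed.

Lemma mulmx_entry_le (R : realType) (m n p : nat) (A : 'M[R]_(m, n))
    (B : 'M[R]_(n, p)) (c : R) i j :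
  0 <= c -> (forall k, `|B k j| <= c) -> `|(A *m B) i j| <= mx_abs_sum A * c.
Proof.
move=> c0 Bc; rewrite mxE; apply: le_trans (ler_norm_sum _ _ _) _.
apply: (@le_trans _ _ (\sum_k `|A i k| * c)).
  by apply: ler_sum => k _; rewrite normrM ler_wpM2l.
rewrite -mulr_suml ler_wpM2r// /mx_abs_sum (bigD1 i)//= lerDl.
by apply: sumr_ge0 => k _; apply: sumr_ge0.
Qed.

Lemma mulmx_norm_le (R : realType) (m n p : nat) (A : 'M[R]_(m, n))
    (B : 'M[R]_(n, p)) : `|A *m B| <= mx_abs_sum A * `|B|.
Proof.
have c0 : 0 <= mx_abs_sum A * `|B| by rewrite mulr_ge0 ?mx_abs_sum_ge0.
rewrite [leLHS]/Num.norm /= mx_normrE; apply/bigmax_leP; split => // -[i j] _.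
by apply: mulmx_entry_le => // k; exact: mx_entry_norm_le.
Qed.

Lemma mx_exp_mul_entry_le (R : realType) (n k : nat) (A B : 'M[R]_n) (c : R) i j :
  0 <= c -> (forall k, `|B k j| <= c) ->
  `|(A ^+ k *m B) i j| <= mx_abs_sum A ^+ k * c.
Proof.
move=> c0 Bc; elim: k i => [|k IH] i; first by rewrite !expr0 mul1mx mul1r.
rewrite !exprS -mulmxE -mulmxA -mulrA; apply: mulmx_entry_le => //.
by rewrite mulr_ge0// exprn_ge0// mx_abs_sum_ge0.
Qed.

Lemma mx_exp_entry_le (R : realType) (n k : nat) (A : 'M[R]_n) i j :
  `|(A ^+ k) i j| <= mx_abs_sum A ^+ k.
Proof.
rewrite -[A ^+ k]mulmx1 -[leRHS]mulr1; apply: mx_exp_mul_entry_le => // l.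
by rewrite mxE; case: eqP => _; rewrite ?normr1 ?normr0.
Qed.

Lemma is_cvg_mexp_entry (R : realType) (n : nat) (A : 'M[R]_n) i j :
  cvgn (fun m => (series (fun k : nat => (k`!%:R)^-1 *: A ^+ k) m) i j).
Proof.
have -> : (fun m => (series (fun k : nat => (k`!%:R)^-1 *: A ^+ k) m) i j) =
    series (fun k => (k`!%:R)^-1 * (A ^+ k) i j).
  apply/funext => m; rewrite /series /= summxE.
  by apply: eq_bigr => k _; rewrite mxE.
apply: normed_cvg.
apply: (series_le_cvg _ _ _ (is_cvg_series_exp_coeff (mx_abs_sum A))) => k //=.
  by rewrite exp_coeff_ge0// mx_abs_sum_ge0.
rewrite exp_coeffE normrM ger0_norm ?invr_ge0//.
by rewrite ler_wpM2l ?invr_ge0// mx_exp_entry_le.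
Qed.

Lemma cvg_mexp (R : realType) (n : nat) (A : 'M[R]_n) :
  series (fun k : nat => (k`!%:R)^-1 *: A ^+ k) @ \oo --> mexp A.
Proof.
pose E : 'M[R]_n := \matrix_(i, j)
  limn (fun m => (series (fun k : nat => (k`!%:R)^-1 *: A ^+ k) m) i j).
have AE : series (fun k : nat => (k`!%:R)^-1 *: A ^+ k) @ \oo --> E.
  apply: cvg_mx_entries => i j; rewrite mxE; exact: is_cvg_mexp_entry.
rewrite /mexp; rewrite (cvg_lim _ AE)//.
Qed.

Lemma cvg_mexp_entry (R : realType) (n : nat) (A : 'M[R]_n) i j :
  (fun m => (\sum_(k < m) (k`!%:R)^-1 *: A ^+ k) i j) @ \oo --> mexp A i j.
Proof.
have := @cvg_mexp R n A.
move=> /cvgrPdist_lt Acvg; apply/cvgrPdist_lt => e e0.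
apply: filterS (Acvg e e0) => m /(mx_norm_ltP _ e0) /(_ i j).
by rewrite !mxE /series /= big_mkord.
Qed.

Lemma mexp0 (R : realType) (n : nat) : mexp (0 : 'M[R]_n) = 1%:M.
Proof.
apply/matrixP => i j.
rewrite -(cvg_lim (@Rhausdorff R) (@cvg_mexp_entry R n 0 i j)).
apply: cvg_lim => //.
apply: cvg_near_cst; exists 1%N => // m /= m0.
rewrite -(prednK m0) big_ord_recl expr0 fact0 invr1 scale1r big1 ?addr0// => k _.
by rewrite expr0n/= scaler0.
Qed.

(** Each entry of the matrix defect is at most the defect of the scalar series at [a] and [b], which
    tends to [expR a * expR b - expR (a + b)], that is, to 0. *)
Lemma mexpD (R : realType) (n : nat) (A B : 'M[R]_n) :
  A *m B = B *m A -> mexp (A + B) = mexp A *m mexp B.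
Proof.
case: n A B => [|n] A B AB; first by apply/matrixP => -[].
set S := fun (C : 'M[R]_n.+1) m => \sum_(k < m) (k`!%:R)^-1 *: C ^+ k.
set a := mx_abs_sum A; set b := mx_abs_sum B.
have a0 : 0 <= a := mx_abs_sum_ge0 _.
have b0 : 0 <= b := mx_abs_sum_ge0 _.
set s := fun (c : R) m => \sum_(k < m) (k`!%:R)^-1 * c ^+ k.
have s_cvg c : s c @ \oo --> expR c.
  have -> : s c = series (exp_coeff c).
    apply/funext => m; rewrite /s /series /= big_mkord exp_coeffE.
    by apply: eq_bigr.
  exact: is_cvg_series_exp_coeff.
have gap0 : (fun m => s a m * s b m - s (a + b) m) @ \oo --> (0 : R).
  rewrite -(subrr (expR (a + b))) {1}expRD.
  by apply: cvgB => //; exact: cvgM.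
apply/matrixP => i j.
have SS : (fun m => (S A m *m S B m) i j) @ \oo --> (mexp A *m mexp B) i j.
  under eq_fun do rewrite mxE.
  by rewrite mxE; apply: cvg_big => [|k _]; [exact: add_continuous|];
    apply: cvgM; exact: cvg_mexp_entry.
have gapM : (fun m => (S A m *m S B m) i j - S (A + B) m i j) @ \oo --> (0 : R).
  apply/cvgr0Pnorm_lt => e e0.
  have /cvgr0Pnorm_lt /(_ e e0) := gap0; apply: filterS => m.
  move=> /(le_lt_trans (ler_norm _)); apply: le_lt_trans.
  have -> : (S A m *m S B m) i j - S (A + B) m i j =
      (S A m * S B m - S (A + B) m) i j by rewrite !mxE.
  rewrite exp_partial_sum_defect// summxE.
  rewrite (@exp_partial_sum_defect R R^o)//; last exact: mulrC.
  apply: le_trans (ler_norm_sum _ _ _) _; apply: ler_sum => k _; rewrite summxE.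
  apply: le_trans (ler_norm_sum _ _ _) _; apply: ler_sum => l _; rewrite mxE.
  rewrite normrM ger0_norm ?mulr_ge0 ?invr_ge0//.
  rewrite ler_wpM2l ?mulr_ge0 ?invr_ge0//.
  apply: mx_exp_mul_entry_le; first exact: exprn_ge0.
  by move=> q; exact: mx_exp_entry_le.
rewrite -(cvg_lim (@Rhausdorff R) (@cvg_mexp_entry R n.+1 (A + B) i j)).
apply: cvg_lim => //.
rewrite -[X in _ --> X]subr0.
rewrite (_ : (fun m => _) = (fun m => (S A m *m S B m) i j -
    ((S A m *m S B m) i j - S (A + B) m i j))); first exact: cvgB.
by apply/funext => m; rewrite subKr.
Qed.

(** * Telescoping over boxes *)

Lemma sum_ord_leq (V : nmodType) (K m : nat) (F : nat -> V) :
  (m <= K)%N -> \sum_(i < K.+1 | (i <= m)%N) F i = \sum_(i < m.+1) F i.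
Proof. by move=> mK; rewrite [RHS](big_ord_widen K.+1). Qed.

(** Differences and end terms are both written as sums over [bool], so that a product over
    coordinates distributes into a sum over corners. The bound [K] is common to all coordinates, as
    in the filtered cube of [psum]. *)
Lemma telescope_bool_sum (R : pzRingType) (f : int -> R) (t : int) (K m : nat) :
  (m <= K)%N ->
  \sum_(i < K.+1 | (i <= m)%N) \sum_(b : bool)
    (-1) ^+ b * f (t - (i : nat)%:Z - (b : nat)%:Z) =
  \sum_(b : bool) (-1) ^+ b * f (t - (b * m.+1)%N%:Z).
Proof.
move=> mK; pose g k := f (t - k%:Z).
rewrite (eq_bigr (fun i : 'I_K.+1 => g i - g i.+1)); last first.
  move=> i _; rewrite big_bool /= expr1 expr0 mul1r mulN1r addrC subr0.
  by rewrite -addrA -opprD -PoszD addn1.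
rewrite (sum_ord_leq (fun i => g i - g i.+1) mK).
rewrite big_bool /= mul1n mul0n expr1 expr0 mul1r mulN1r addrC.
rewrite -/(g 0%N) -/(g m.+1); elim: (m.+1) => [|k IH].
  by rewrite big_ord0 subrr.
by rewrite big_ord_recr /= IH addrA subrK.
Qed.

(** The outer corners of the box: telescoping leaves a value one step below the last summand, hence
    [(M l).+1]. *)
Definition jump {N : nat} (t : idx N) (M : 'I_N -> nat)
    (b : {ffun 'I_N -> bool}) : idx N :=
  fun l => t l - (b l * (M l).+1)%N%:Z.

Lemma jump_update_in (N : nat) (t : idx N) (M : 'I_N -> nat) (b : {ffun 'I_N -> bool})
    (k : 'I_N) (m : nat) : b k ->
  jump t (fun l => if l == k then m else M l) b =
  setc (jump t M b) k (t k - m.+1%:Z).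
Proof.
move=> bk; apply/funext => l; rewrite /setc /jump.
by case: eqP => // ->; rewrite bk mul1n.
Qed.

Lemma jump_update_out (N : nat) (t : idx N) (M : 'I_N -> nat) (b : {ffun 'I_N -> bool})
    (k : 'I_N) (m : nat) : ~~ b k ->
  jump t (fun l => if l == k then m else M l) b = jump t M b.
Proof.
move=> bk; apply/funext => l; rewrite /jump; case: eqP => // ->.
by rewrite (negbTE bk) !mul0n.
Qed.

Definition back {N : nat} (t : idx N) (c : 'I_N -> nat) : idx N :=
  fun l => t l - (c l)%:Z.

Lemma sign_bsize (R : comPzRingType) (N : nat) (b : {ffun 'I_N -> bool}) :
  (-1) ^+ bsize b = \prod_(l < N) (-1) ^+ b l :> R.
Proof. by rewrite /bsize; elim/big_rec2: _ => // l x y _; rewrite exprD => ->. Qed.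

(** For a product of functions of one coordinate both sides factor, and each factor is the
    one-dimensional telescoping. *)
Lemma box_sum_Delta_prod (R : comPzRingType) (N K : nat) (f : 'I_N -> int -> R)
    (t : idx N) (M : 'I_N -> nat) :
  (forall l, (M l <= K)%N) ->
  \sum_(i : {ffun 'I_N -> 'I_K.+1} | [forall l, (i l <= M l)%N])
    \sum_(b : {ffun 'I_N -> bool})
      (-1) ^+ bsize b * \prod_l f l (subi (back t (fun l => i l)) b l) =
  \sum_(b : {ffun 'I_N -> bool}) (-1) ^+ bsize b * \prod_l f l (jump t M b l).
Proof.
move=> MK.
under [RHS]eq_bigr do rewrite sign_bsize -big_split.
rewrite -(bigA_distr_bigA (fun l (b : bool) =>
  (-1) ^+ b * f l (t l - (b * (M l).+1)%N%:Z))).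
under [RHS]eq_bigr => l _ do rewrite -(telescope_bool_sum (f l) (t l) (MK l)).
rewrite bigA_distr_big_dep; apply: eq_big => [i|i _].
  by apply/forallP/familyP.
rewrite bigA_distr_bigA; apply: eq_bigr => b _.
by rewrite sign_bsize -big_split.
Qed.

(* Every field restricted to a finite box is a combination of indicators of
   points, which are products of functions of one coordinate. *)
Lemma box_sum_Delta (R : comPzRingType) (V : lmodType R) (N K : nat) (y : idx N -> V)
    (t : idx N) (M : 'I_N -> nat) :
  (forall l, (M l <= K)%N) ->
  \sum_(i : {ffun 'I_N -> 'I_K.+1} | [forall l, (i l <= M l)%N])
    \sum_(b : {ffun 'I_N -> bool})
      (-1) ^+ bsize b *: y (subi (back t (fun l => i l)) b) =
  \sum_(b : {ffun 'I_N -> bool}) (-1) ^+ bsize b *: y (jump t M b).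
Proof.
move=> MK.
(* Offsets reach [K.+1]: a difference moves a point of the box one step further down, and the outer
   corners lie at [(M l).+1]. *)
pose pt (u : {ffun 'I_N -> 'I_K.+2}) := back t (fun l => u l).
pose e (u : {ffun 'I_N -> 'I_K.+2}) l (x : int) : R := (x == pt u l)%:R.
have yE (s : idx N) (c : 'I_N -> nat) : s = back t c ->
    (forall l, (c l <= K.+1)%N) -> y s = \sum_u (\prod_l e u l (s l)) *: y (pt u).
  move=> -> cK; pose u : {ffun 'I_N -> 'I_K.+2} := [ffun l => inord (c l)].
  have uE : pt u = back t c.
    by apply/funext => l; rewrite /pt /back ffunE inordK// ltnS.
  rewrite (bigD1 u)//= big1 => [|l _]; last by rewrite /e uE eqxx.
  rewrite scale1r uE big1 ?addr0// => v vu.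
  have [l vl] : exists l, v l != u l.
    apply/existsP; rewrite -negb_forall; apply: contra vu => /forallP vu.
    by apply/eqP/ffunP => l; exact/eqP.
  rewrite (bigD1 l)//= {1}/e -uE /pt /back (inj_eq (addrI _)) eqr_opp.
  by rewrite eqz_nat eq_sym (inj_eq val_inj) (negPf vl) mul0r scale0r.
have lin (I : finType) (Q : pred I) (s : I -> {ffun 'I_N -> bool} -> idx N) :
    (forall i b, Q i -> exists2 c, s i b = back t c & forall l, (c l <= K.+1)%N) ->
    \sum_(i | Q i) \sum_b (-1) ^+ bsize b *: y (s i b) =
    \sum_u (\sum_(i | Q i) \sum_b (-1) ^+ bsize b * \prod_l e u l (s i b l)) *: y (pt u).
  move=> sQ; under [RHS]eq_bigr do rewrite scaler_suml.
  rewrite [RHS]exchange_big; apply: eq_bigr => i Qi /=.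
  under [RHS]eq_bigr do rewrite scaler_suml.
  rewrite [RHS]exchange_big; apply: eq_bigr => b _ /=.
  have [c sc cK] := sQ i b Qi.
  rewrite {1}(yE _ _ sc cK) scaler_sumr.
  by apply: eq_bigr => u _; rewrite scalerA.
rewrite lin => [|i b /forallP iM]; last first.
  exists (fun l => (i l + b l)%N) => [|l].
    by apply/funext => l; rewrite /subi /back PoszD opprD addrA.
  rewrite -[leqRHS]addn1; apply: leq_add; last exact: leq_b1.
  exact: leq_trans (iM l) (MK l).
(* The right side is read as an outer sum over a one-element type, so that [lin] expands both
   sides. *)
have unitE (V' : nmodType) (F : unit -> V') : \sum_i F i = F tt.
  by rewrite (big_pred1 tt)// => -[].
have := lin unit xpredT (fun _ b => jump t M b); rewrite unitE => ->; last first.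
  move=> _ b _; exists (fun l => b l * (M l).+1)%N => // l.
  by case: (b l); rewrite ?mul1n ?mul0n// ltnS.
by apply: eq_bigr => u _; rewrite unitE box_sum_Delta_prod.
Qed.

(** * Additivity of [tstar] and of its exponential *)

Lemma tstarD (R : realType) (N n : nat) (s t : idx N) (Th : 'I_N -> 'M[R]_n) :
  tstar (fun l => s l + t l) Th = tstar s Th + tstar t Th.
Proof.
by rewrite /tstar -big_split; apply: eq_bigr => l _; rewrite intrD scalerDl.
Qed.

Lemma tstarN (R : realType) (N n : nat) (t : idx N) (Th : 'I_N -> 'M[R]_n) :
  tstar (fun l => - t l) Th = - tstar t Th.
Proof.
by rewrite /tstar -sumrN; apply: eq_bigr => l _; rewrite intrN scaleNr.
Qed.

Section CommutingGenerators.
Context {R : realType} {N n : nat} (Th : 'I_N -> 'M[R]_n).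
Context (Th_comm : forall j k, Th j *m Th k = Th k *m Th j).

Lemma tstar_comm (s t : idx N) :
  tstar s Th *m tstar t Th = tstar t Th *m tstar s Th.
Proof.
rewrite /tstar mulmx_suml [RHS]mulmx_sumr; apply: eq_bigr => j _.
rewrite mulmx_suml mulmx_sumr; apply: eq_bigr => k _.
by rewrite -!scalemxAl -!scalemxAr Th_comm !scalerA mulrC.
Qed.

Lemma mexp_tstarD (s t u : idx N) : (forall l, s l + t l = u l) ->
  mexp (tstar s Th) *m mexp (tstar t Th) = mexp (tstar u Th).
Proof.
move=> /funext <-; rewrite (tstarD s t) mexpD//; exact: tstar_comm.
Qed.

Lemma mexp_tstarK (t : idx N) :
  mexp (- tstar t Th) *m mexp (tstar t Th) = 1%:M.
Proof. by rewrite -mexpD ?addNr ?mexp0// mulNmx mulmxN. Qed.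

End CommutingGenerators.

(** * Convergence in probability *)

Section RandomVectors.
Context {d : measure_display} {Omega : measurableType d} {R : realType}.
Implicit Types (P : probability Omega R).

Lemma is_rvec0 (n : nat) : is_rvec (0 : @rvec d Omega R n).
Proof.
move=> i j; rewrite (_ : (fun _ => _) = cst 0); first exact: measurable_cst.
by apply/funext => w; rewrite mxE.
Qed.

Lemma is_rvecD (n : nat) (A B : @rvec d Omega R n) :
  is_rvec A -> is_rvec B -> is_rvec (fun w => A w + B w).
Proof.
move=> mA mB i j; rewrite (_ : (fun _ => _) = (fun w => A w i j) \+ (fun w => B w i j)).
  exact: measurable_funD.
by apply/funext => w; rewrite mxE.
Qed.

Lemma is_rvec_mulmx (m n : nat) (C : 'M[R]_(m, n)) (A : @rvec d Omega R n) :
  is_rvec A -> is_rvec (fun w => C *m A w).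
Proof.
move=> mA i j; rewrite (_ : (fun _ => _) = (fun w => \sum_k C i k * A w k j)).
  by apply: measurable_sum => k; apply: measurable_funM.
by apply/funext => w; rewrite mxE.
Qed.

Lemma is_rvecZ (n : nat) (c : R) (A : @rvec d Omega R n) :
  is_rvec A -> is_rvec (fun w => c *: A w).
Proof.
by move=> /(is_rvec_mulmx c%:M); under eq_fun do rewrite mul_scalar_mx.
Qed.

Lemma is_rvecB (n : nat) (A B : @rvec d Omega R n) :
  is_rvec A -> is_rvec B -> is_rvec (fun w => A w - B w).
Proof.
move=> mA mB; under eq_fun do rewrite -scaleN1r.
by apply: is_rvecD => //; exact: is_rvecZ.
Qed.

Lemma is_rvec_sum (n : nat) (I : Type) (s : seq I) (Q : pred I)
    (A : I -> @rvec d Omega R n) :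
  (forall i, Q i -> is_rvec (A i)) -> is_rvec (fun w => \sum_(i <- s | Q i) A i w).
Proof.
move=> mA; elim: s => [|i s IH].
  by under eq_fun do rewrite big_nil; exact: is_rvec0.
under eq_fun do rewrite big_cons; case Qi : (Q i) => //.
by apply: is_rvecD => //; exact: mA.
Qed.

Lemma measurable_norm_ge (n : nat) (Y : @rvec d Omega R n) (eps : R) :
  is_rvec Y -> 0 < eps -> measurable [set w | eps <= `|Y w|].
Proof.
move=> mY eps0.
rewrite (_ : [set _ | _] = ~` \bigcap_(i in [set: 'I_n])
    ((fun w => `|Y w i 0|) @^-1` `]-oo, eps[)).
  apply: measurableC; apply: fin_bigcap_measurable; first exact: finite_finset.
  move=> i _; rewrite -[_ @^-1` _]setTI.
  by apply: (measurableT_comp (@normr_measurable R setT) (mY i 0)).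
apply/seteqP; split => w /=.
  rewrite leNgt => /negP Yw H; apply: Yw; apply/(mx_norm_ltP _ eps0) => i j.
  by have := H i I; rewrite /= in_itv /= !ord1.
move=> H; rewrite leNgt; apply/negP => /(mx_norm_ltP _ eps0) Yw.
by apply: H => i _ /=; rewrite in_itv /=.
Qed.

(** Squeezing of deviation probabilities. The threshold and the dimension may change, which covers
    linear images, almost sure modifications and eventual equality. *)
Lemma cvg_prob_near_le P (n m : nat) (Y : nat -> @rvec d Omega R n) (L : rvec n)
    (Y' : nat -> @rvec d Omega R m) (L' : rvec m) :
  (forall eps : R, 0 < eps -> exists2 e : R, 0 < e &
    \forall k \near \oo, (P [set w | (eps <= `|Y' k w - L' w|)%R] <=
                          P [set w | (e <= `|Y k w - L w|)%R])%E) ->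
  cvg_prob P Y L -> cvg_prob P Y' L'.
Proof.
move=> H YL eps eps0; have [e e0 He] := H eps eps0.
apply: (squeeze_cvge (f := fun=> 0%E) _ _ (YL e e0)); last exact: cvg_cst.
by apply: filterS He => k ->; rewrite measure_ge0.
Qed.

Lemma cvg_probD P (n : nat) (A B : nat -> @rvec d Omega R n) a b :
  (forall k, is_rvec (A k)) -> (forall k, is_rvec (B k)) -> is_rvec a -> is_rvec b ->
  cvg_prob P A a -> cvg_prob P B b ->
  cvg_prob P (fun k w => A k w + B k w) (fun w => a w + b w).
Proof.
move=> mA mB ma mb Aa Bb eps eps0.
have e0 : 0 < eps / 2 by rewrite divr_gt0.
have := cvgeD (isT : (0 +? (0 : \bar R))%E) (Aa _ e0) (Bb _ e0).
rewrite adde0 => AB.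
apply: (squeeze_cvge (f := fun=> 0%E) _ _ (AB _)); last exact: cvg_cst.
near=> k; rewrite measure_ge0 /=.
have mAk := measurable_norm_ge (is_rvecB (mA k) ma) e0.
have mBk := measurable_norm_ge (is_rvecB (mB k) mb) e0.
apply: le_trans (measureU2 _ mAk mBk); apply: le_measure.
- rewrite inE; apply: measurable_norm_ge => //.
  by apply: is_rvecB; apply: is_rvecD.
- by rewrite inE; exact: measurableU.
- move=> w /=; have [|Ak] := leP (eps / 2) `|A k w - a w|; first by left.
  have [|Bk] := leP (eps / 2) `|B k w - b w|; first by right.
  rewrite leNgt => /negP[]; rewrite opprD addrACA.
  by apply: le_lt_trans (ler_normD _ _) _; rewrite [eps]splitr ltrD.
Unshelve. all: by end_near. Qed.

Lemma cvg_prob_mulmx P (m n : nat) (C : 'M[R]_(m, n)) (A : nat -> @rvec d Omega R n) a :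
  (forall k, is_rvec (A k)) -> is_rvec a ->
  cvg_prob P A a -> cvg_prob P (fun k w => C *m A k w) (fun w => C *m a w).
Proof.
move=> mA ma; apply: cvg_prob_near_le => eps eps0.
(* The summand 1 keeps the divisor positive when [C] is zero. *)
have c0 : 0 < 1 + mx_abs_sum C by rewrite ltr_pwDl// mx_abs_sum_ge0.
exists (eps / (1 + mx_abs_sum C)); first exact: divr_gt0.
near=> k; apply: le_measure.
- rewrite inE; apply: measurable_norm_ge => //.
  by apply: is_rvecB; apply: is_rvec_mulmx.
- by rewrite inE; apply: measurable_norm_ge; [exact: is_rvecB|exact: divr_gt0].
- move=> w /=; rewrite -mulmxBr ler_pdivrMr// mulrC => /le_trans; apply.
  apply: le_trans (mulmx_norm_le _ _) _.
  by rewrite ler_wpM2r// lerDr.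
Unshelve. all: by end_near. Qed.

Lemma cvg_prob_cst P (n : nat) (L : @rvec d Omega R n) : cvg_prob P (fun=> L) L.
Proof.
move=> eps eps0; rewrite (_ : (fun _ => _) = cst 0%E); first exact: cvg_cst.
apply/funext => _ /=; rewrite (_ : [set _ | _] = set0) ?measure0//.
by apply/seteqP; split => // w /=; rewrite subrr normr0 leNgt eps0.
Qed.

Lemma cvg_prob_sum P (n : nat) (I : Type) (s : seq I) (Q : pred I)
    (A : I -> nat -> @rvec d Omega R n) (a : I -> @rvec d Omega R n) :
  (forall i k, Q i -> is_rvec (A i k)) -> (forall i, Q i -> is_rvec (a i)) ->
  (forall i, Q i -> cvg_prob P (A i) (a i)) ->
  cvg_prob P (fun k w => \sum_(i <- s | Q i) A i k w)
             (fun w => \sum_(i <- s | Q i) a i w).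
Proof.
move=> mA ma Aa; elim: s => [|i s IH].
  rewrite (_ : (fun _ _ => _) = fun=> (fun w => \sum_(i <- [::] | Q i) a i w)).
    exact: cvg_prob_cst.
  by apply/funext => k; apply/funext => w; rewrite !big_nil.
pose step (b c : @rvec d Omega R n) : @rvec d Omega R n :=
  fun w => if Q i then b w + c w else c w.
rewrite (_ : (fun _ _ => _) =
    fun k => step (A i k) (fun w => \sum_(i <- s | Q i) A i k w)); last first.
  by apply/funext => k; apply/funext => w; rewrite big_cons.
rewrite (_ : (fun _ => _) = step (a i) (fun w => \sum_(i <- s | Q i) a i w)); last first.
  by apply/funext => w; rewrite big_cons.
rewrite /step; case Qi : (Q i) => //; apply: cvg_probD; last exact: IH.
- by move=> k; exact: mA.
- by move=> k; apply: is_rvec_sum => j; exact: mA.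
- exact: ma.
- by apply: is_rvec_sum => j; exact: ma.
- exact: Aa.
Qed.

Lemma le_measure_ae P (A B : set Omega) : measurable A -> measurable B ->
  {ae P, forall w, A w -> B w} -> (P A <= P B)%E.
Proof.
move=> mA mB [N [mN PN AB]].
apply: (@le_trans _ _ (P (B `|` N))); last first.
  apply: le_trans (measureU2 _ mB mN) _; rewrite -[leRHS]adde0.
  apply: leeD => //; move: PN; set x := (X in X = _); set y := (X in (X <= _)%E).
  by rewrite -[y]/x => ->.
apply: le_measure; rewrite ?inE//; first exact: measurableU.
move=> w Aw; have [Bw|Bw] := pselect (B w); first by left.
by right; apply: AB => /= H; apply: Bw; exact: H.
Qed.

Lemma cvg_prob_ae P (n : nat) (A A' : nat -> @rvec d Omega R n) L L' :
  (forall k, is_rvec (A k)) -> (forall k, is_rvec (A' k)) -> is_rvec L -> is_rvec L' ->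
  (forall k, {ae P, forall w, A k w = A' k w}) -> {ae P, forall w, L w = L' w} ->
  cvg_prob P A L -> cvg_prob P A' L'.
Proof.
move=> mA mA' mL mL' AA' LL'; apply: cvg_prob_near_le => eps eps0; exists eps => //.
near=> k; apply: le_measure_ae.
- by apply: measurable_norm_ge => //; exact: is_rvecB.
- by apply: measurable_norm_ge => //; exact: is_rvecB.
- by apply: filterS2 LL' (AA' k) => w LLw AAw /=; rewrite LLw AAw.
Unshelve. all: by end_near. Qed.

(** The null sequence [A k - A k] also converges to [L - L'], so every deviation of fixed size has
    probability 0; countably many sizes exhaust the event that [L] and [L'] differ. *)
Lemma cvg_prob_unique P (n : nat) (A : nat -> @rvec d Omega R n) L L' :
  (forall k, is_rvec (A k)) -> is_rvec L -> is_rvec L' ->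
  cvg_prob P A L -> cvg_prob P A L' -> {ae P, forall w, L w = L' w}.
Proof.
move=> mA mL mL' AL AL'.
have AN : cvg_prob P (fun k w => -1%:M *m A k w) (fun w => - 1%:M *m L' w).
  exact: cvg_prob_mulmx.
have mN k : is_rvec (fun w => - 1%:M *m A k w) by exact: is_rvec_mulmx.
have mLN : is_rvec (fun w => - 1%:M *m L' w) by exact: is_rvec_mulmx.
have mZ : is_rvec (fun w => L w - L' w) by exact: is_rvecB.
have small (e : R) : 0 < e -> P [set w | e <= `|L w - L' w|] = 0%E.
  move=> e0; have := cvg_probD mA mN mL mLN AL AN e0.
  rewrite (_ : (fun _ => _) = cst (P [set w | e <= `|L w - L' w|])).
    by move=> /cvg_lim <- //; rewrite lim_cst.
  apply/funext => k /=; congr (P _); apply/seteqP; split => w /=;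
    by rewrite !mulNmx !mul1mx subrr add0r opprB distrC.
have : P.-negligible (\bigcup_k [set w | k.+1%:R^-1 <= `|L w - L' w|]).
  apply: negligible_bigcup => k; apply/negligibleP.
    by apply: measurable_norm_ge => //; rewrite invr_gt0.
  by apply: small; rewrite invr_gt0.
apply: negligibleS => w /= LL'.
have /eqP LL'0 : L w - L' w <> 0 by move=> /eqP; rewrite subr_eq0 => /eqP.
have z0 : 0 < `|L w - L' w| by rewrite normr_gt0.
exists (Num.truncn (`|L w - L' w|^-1)) => //=.
rewrite invf_ple ?posrE//.
by apply/ltW; exact/real_truncnS_gt/num_real.
Qed.

Lemma cvg_prob_reindex P (n : nat) (A : nat -> @rvec d Omega R n) L (h : nat -> nat) :
  h @ \oo --> \oo -> cvg_prob P A L -> cvg_prob P (A \o h) L.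
Proof. by move=> hoo AL eps eps0; exact: (cvg_comp _ _ hoo (AL eps eps0)). Qed.

Lemma cvg_prob_near_eq P (n : nat) (A A' : nat -> @rvec d Omega R n) L :
  (\forall k \near \oo, A k = A' k) -> cvg_prob P A L -> cvg_prob P A' L.
Proof.
move=> AA'; apply: cvg_prob_near_le => eps eps0; exists eps => //.
by apply: filterS AA' => k ->.
Qed.

End RandomVectors.

(** * Equality in law *)

Section Laws.
Context {d : measure_display} {Omega : measurableType d} {R : realType}.
Implicit Types (P : probability Omega R).

(** The generators inside [borel_mx], named so that its members become the measurable sets of a
    [g_sigma_algebraType]. *)
Definition mx_cylinder {n k : nat} : set (set 'M[R]_(n, k)) :=
  [set A | exists (i : 'I_n) (l : 'I_k) (B : set R),
    measurable B /\ A = [set M : 'M[R]_(n, k) | B (M i l)]].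

Lemma borel_mxE (n k : nat) :
  @borel_mx R n k = @measurable _ (g_sigma_algebraType (@mx_cylinder n k)).
Proof. by []. Qed.

Lemma measurable_entry (n k : nat) (i : 'I_n) (l : 'I_k) :
  measurable_fun setT ((fun M => M i l) : g_sigma_algebraType (@mx_cylinder n k) -> R).
Proof.
move=> _ B mB; rewrite setTI; apply: sub_sigma_algebra.
by exists i, l, B.
Qed.

(** Lists make the family stable under intersection by concatenation; [x] moves all thresholds at
    once, for perturbation arguments. *)
Definition half_spaces {n k : nat} (x : R) (s : seq ('I_n * 'I_k * R)) :
    set 'M[R]_(n, k) :=
  [set M | all (fun c => M c.1.1 c.1.2 < c.2 + x) s].

Lemma borel_half_spaces (n k : nat) (x : R) s : borel_mx (half_spaces x s : set 'M[R]_(n, k)).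
Proof.
rewrite borel_mxE; elim: s => [|c s IH].
  by rewrite (_ : half_spaces _ _ = setT)//; apply/seteqP; split.
rewrite (_ : half_spaces _ _ =
    ((fun M : 'M[R]_(n, k) => M c.1.1 c.1.2) @^-1` `]-oo, (c.2 + x)[) `&`
    half_spaces x s).
  apply: measurableI => //; rewrite -[_ @^-1` _]setTI.
  exact: measurable_entry.
by apply/seteqP; split => M; rewrite /half_spaces /= !in_itv /= => /andP.
Qed.

Lemma setI_closed_half_spaces (n k : nat) :
  setI_closed (range (@half_spaces n k 0)).
Proof.
move=> _ _ [s _ <-] [s' _ <-]; exists (s ++ s') => //.
by apply/seteqP; split => M; rewrite /half_spaces /= all_cat => /andP.
Qed.

Lemma measurable_entry_half_spaces (n k : nat) (i : 'I_n) (l : 'I_k) :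
  measurable_fun setT
    ((fun M => M i l) : g_sigma_algebraType (range (@half_spaces n k 0)) -> R).
Proof.
apply: (measurability _ (RGenInftyO.measurableE R)) => _ [_ [x ->] <-].
rewrite setTI; apply: sub_sigma_algebra; exists [:: (i, l, x)] => //.
by apply/seteqP; split => M; rewrite /half_spaces /= in_itv /= addr0 andbT.
Qed.

Lemma borel_mx_half_spaces (n k : nat) :
  @borel_mx R n k `<=` <<s range (@half_spaces n k 0) >>.
Proof.
apply: smallest_sub; first exact: smallest_sigma_algebra.
move=> _ [i [l [B [mB ->]]]].
have := @measurable_entry_half_spaces n k i l measurableT B mB.
by rewrite setTI.
Qed.

Lemma measurable_joint_half_spaces (N n k : nat) (Y : @rfield d Omega R N n)
    (ts : 'I_k -> idx N) (x : R) s : is_rfield Y ->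
  measurable (joint Y ts @^-1` half_spaces x s).
Proof.
move=> mY; elim: s => [|c s IH].
  by rewrite (_ : _ @^-1` _ = setT)//; apply/seteqP; split.
rewrite (_ : _ @^-1` _ = ((fun w => Y (ts c.1.2) w c.1.1 0) @^-1` `]-oo, (c.2 + x)[) `&`
    (joint Y ts @^-1` half_spaces x s)).
  apply: measurableI => //; rewrite -[_ @^-1` _]setTI.
  exact: (mY (ts c.1.2) c.1.1 0).
apply/seteqP; split => w; rewrite /half_spaces /= !in_itv /= mxE.
  by move=> /andP.
by move=> [-> ->].
Qed.

Lemma measurable_joint (N n k : nat) (Y : @rfield d Omega R N n)
    (ts : 'I_k -> idx N) : is_rfield Y ->
  measurable_fun setT
    (joint Y ts : Omega -> g_sigma_algebraType (range (@half_spaces n k 0))).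
Proof.
move=> mY; apply: (@measurability _ _ _ (g_sigma_algebraType (range (@half_spaces n k 0)))
  setT _ (range (@half_spaces n k 0))) => //.
move=> _ [_ [s _ <-] <-]; rewrite setTI; exact: measurable_joint_half_spaces.
Qed.

(** Dynkin's theorem: the half-space sets at level 0 are stable under intersection and generate the
    Borel sets. *)
Lemma eq_law_half_spaces P (N n : nat) (Y Z : @rfield d Omega R N n) :
  is_rfield Y -> is_rfield Z ->
  (forall k (ts : 'I_k -> idx N) s, P (joint Y ts @^-1` half_spaces 0 s) =
                                   P (joint Z ts @^-1` half_spaces 0 s)) ->
  eq_law P Y Z.
Proof.
move=> mY mZ YZ k ts A /borel_mx_half_spaces.
pose T := g_sigma_algebraType (range (@half_spaces n k 0)).
have mF (F : @rfield d Omega R N n) : is_rfield F ->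
    forall S : set T, measurable S -> measurable (joint F ts @^-1` S).
  by move=> mF S mS; rewrite -[_ @^-1` _]setTI; exact: (measurable_joint _ mF).
apply: (@dynkin_induction _ T (range (@half_spaces n k 0))
  (fun A => P (joint Y ts @^-1` A) = P (joint Z ts @^-1` A))) => //.
- exact: setI_closed_half_spaces.
- by move=> _ [s _ <-]; exact: YZ.
- move=> S mS YZS.
  have cE (X : @rfield d Omega R N n) : is_rfield X ->
      P (joint X ts @^-1` (~` S)) = (1 - P (joint X ts @^-1` S))%E.
    by move=> mX; rewrite preimage_setC; apply: probability_setC; exact: mF.
  by rewrite (cE Y mY) (cE Z mZ) YZS.
- move=> F mFn tF YZF; rewrite !preimage_bigcup.
  have bc (X : @rfield d Omega R N n) : is_rfield X ->
      P (\bigcup_i joint X ts @^-1` F i) = (\sum_(i <oo) P (joint X ts @^-1` F i))%E.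
    move=> mX; apply: measure_semi_bigcup => [i||].
    + exact: mF.
    + apply/trivIsetP => i j _ _ ij; rewrite -preimage_setI.
      by move/trivIsetP : tF => /(_ _ _ _ _ ij) ->//; rewrite preimage_set0.
    + by apply: bigcup_measurable => i _; exact: mF.
  by rewrite (bc Y mY) (bc Z mZ); apply: eq_eseriesr => i _.
Qed.

(** Unless some [Z (ts l)] is at distance at least [e] from [Y (ts l)], every entry grows by less
    than [e], so raising the thresholds by [e] suffices; the exceptions are handled by a union
    bound. *)
Lemma half_spaces_perturb P (N n k : nat) (Y Z : @rfield d Omega R N n)
    (ts : 'I_k -> idx N) (x e : R) s :
  is_rfield Y -> is_rfield Z -> 0 < e ->
  (P (joint Y ts @^-1` half_spaces x s) <=
   P (joint Z ts @^-1` half_spaces (x + e) s) +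
   \sum_(l < k) P [set w | (e <= `|Z (ts l) w - Y (ts l) w|)%R])%E.
Proof.
move=> mY mZ e0.
have mD l : measurable [set w | e <= `|Z (ts l) w - Y (ts l) w|].
  by apply: measurable_norm_ge => //; apply: is_rvecB; [exact: mZ|exact: mY].
pose D := \big[setU/set0]_(l < k) [set w | e <= `|Z (ts l) w - Y (ts l) w|].
have mDD : measurable D by exact: bigsetU_measurable.
have PD : (P D <= \sum_(l < k) P [set w | (e <= `|Z (ts l) w - Y (ts l) w|)%R])%E.
  rewrite /D; elim: (index_enum _) => [|l r IH].
    by rewrite !big_nil measure0.
  rewrite !big_cons; apply: le_trans (measureU2 _ _ _) _ => //.
    exact: bigsetU_measurable.
  exact: leeD.
have mJ := measurable_joint_half_spaces ts (x + e) s mZ.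
apply: le_trans (leeD (lexx _) PD); apply: le_trans (measureU2 _ mJ mDD).
apply: le_measure; rewrite ?inE.
- exact: measurable_joint_half_spaces.
- exact: measurableU.
- move=> w Yw; have [Dw|nDw] := pselect (D w); [by right|left].
  apply/allP => c cs; move/allP : Yw => /(_ c cs); rewrite !mxE => Yw.
  have : `|Z (ts c.1.2) w - Y (ts c.1.2) w| < e.
    rewrite ltNge; apply/negP => De; apply: nDw.
    by rewrite /D -bigcup_seq; exists c.1.2 => //=; rewrite mem_index_enum.
  move=> /(mx_norm_ltP _ e0) /(_ c.1.1 0); rewrite !mxE => /(le_lt_trans (ler_norm _)).
  by rewrite ltrBlDr => /lt_le_trans; apply; lra.
Qed.

(** The inequality is first proved with the left set shrunk by [e]. Continuity from below then lets
    the shrinking tend to 0, since the strict inequalities make the set the union of its shrunken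
    copies. *)
Lemma half_spaces_le_cvg_prob P (N n k : nat) (U V : nat -> @rfield d Omega R N n)
    (Y Z : @rfield d Omega R N n) (ts : 'I_k -> idx N) s :
  (forall m, is_rfield (U m)) -> (forall m, is_rfield (V m)) ->
  is_rfield Y -> is_rfield Z ->
  (forall t, cvg_prob P (fun m => U m t) (Y t)) ->
  (forall t, cvg_prob P (fun m => V m t) (Z t)) ->
  (forall m, eq_law P (U m) (V m)) ->
  (P (joint Y ts @^-1` half_spaces 0 s) <= P (joint Z ts @^-1` half_spaces 0 s))%E.
Proof.
move=> mU mV mY mZ UY VZ UV.
have main (e : R) : 0 < e -> (P (joint Y ts @^-1` half_spaces (- e) s) <=
    P (joint Z ts @^-1` half_spaces 0 s))%E.
  (* One half of [e] pays for the passage from [Y] to [U m], the other for that from [V m] to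
     [Z]. *)
  move=> ee0; have e0 : 0 < e / 2 by rewrite divr_gt0.
  pose p m := (\sum_(l < k) P [set w | (e / 2 <= `|U m (ts l) w - Y (ts l) w|)%R])%E.
  pose q m := (\sum_(l < k) P [set w | (e / 2 <= `|V m (ts l) w - Z (ts l) w|)%R])%E.
  have sum0 (A : 'I_k -> nat -> \bar R) : (forall l m, 0 <= A l m)%E ->
      (forall l, A l @ \oo --> 0%E) -> (fun m => \sum_(l < k) A l m)%E @ \oo --> 0%E.
    move=> A_ge0 A0; have := @cvg_nnesum nat \oo _ R 'I_k (index_enum _) A (fun=> 0%E) xpredT.
    rewrite big1_eq; apply=> l _; last exact: A0.
    by near=> m; exact: A_ge0.
  have p0 : p @ \oo --> 0%E by apply: sum0 => [l m|l]; [exact: measure_ge0|exact: UY].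
  have q0 : q @ \oo --> 0%E by apply: sum0 => [l m|l]; [exact: measure_ge0|exact: VZ].
  have pq0 : (fun m => P (joint Z ts @^-1` half_spaces 0 s) + (q m + p m))%E @ \oo -->
      P (joint Z ts @^-1` half_spaces 0 s).
    rewrite -[X in _ --> X]adde0; apply: cvgeD; [exact: fin_num_adde_defl|exact: cvg_cst|].
    by rewrite -[X in _ --> X]adde0; apply: cvgeD.
  apply: cvge_to_ge pq0 _; near=> m.
  apply: le_trans (half_spaces_perturb P ts (- e) s mY (mU m) e0) _.
  rewrite addeA; apply: leeD => //.
  have eqh : - e + e / 2 = - (e / 2) by rewrite {1}[e]splitr opprD addrNK.
  rewrite eqh (UV m k ts _ (borel_half_spaces _ _)) -[X in (_ <= P (_ @^-1` half_spaces X _) + _)%E](addNr (e / 2)).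
  apply: le_trans (half_spaces_perturb P ts (- (e / 2)) s (mV m) mZ e0) _.
  rewrite leeD2l// /q; apply: lee_sum => l _.
  by under [X in P X]eq_set do rewrite distrC.
have -> : joint Y ts @^-1` half_spaces 0 s =
    \bigcup_j (joint Y ts @^-1` half_spaces (- j.+1%:R^-1) s).
  apply/seteqP; split => w; last first.
    move=> [j _] /allP Yw; apply/allP => c /Yw /lt_le_trans; apply.
    by rewrite lerD2l oppr_le0 invr_ge0.
  move=> Yw; pose M := joint Y ts w.
  (* Finitely many strict inequalities have a common slack; taking half of each individual slack
     keeps them strict. *)
  have [e e0 eM] : exists2 e : R, 0 < e & all (fun c => M c.1.1 c.1.2 < c.2 - e) s.
    move: Yw; rewrite /half_spaces /= -/M; elim: (s) => [|c s' IH] /=.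
      by exists 1.
    move=> /andP[Mc /IH[e e0 es']].
    pose f := Num.min e ((c.2 - M c.1.1 c.1.2) / 2).
    have f0 : 0 < f by rewrite lt_min e0/=; lra.
    have fe : f <= e by rewrite ge_min lexx.
    have fc : f <= (c.2 - M c.1.1 c.1.2) / 2 by rewrite ge_min lexx orbT.
    exists f => //; apply/andP; split; first by lra.
    by apply: sub_all es' => c'; lra.
  exists (Num.truncn e^-1) => //; apply: sub_all eM => c /lt_le_trans; apply.
  rewrite lerD2l lerN2 invf_ple ?posrE//.
  by apply/ltW; exact/real_truncnS_gt/num_real.
have mJ j := measurable_joint_half_spaces ts (- j.+1%:R^-1) s mY.
have mono : nondecreasing_seq (fun j => joint Y ts @^-1` half_spaces (- j.+1%:R^-1) s).
  move=> i j ij; apply/subsetPset => w /allP Yw; apply/allP => c /Yw /lt_le_trans; apply.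
  by rewrite lerD2l lerN2 lef_pV2 ?posrE// ler_nat.
have := nondecreasing_cvg_mu (mu := P) mJ (bigcup_measurable (fun j _ => mJ j)) mono.
move=> /cvg_lim <- //; apply: lime_le; last by near=> j; apply: main; rewrite invr_gt0.
exact: cvgP (nondecreasing_cvg_mu (mu := P) mJ (bigcup_measurable (fun j _ => mJ j)) mono).
Unshelve. all: by end_near. Qed.

Lemma eq_law_cvg_prob P (N n : nat) (U V : nat -> @rfield d Omega R N n)
    (Y Z : @rfield d Omega R N n) :
  (forall m, is_rfield (U m)) -> (forall m, is_rfield (V m)) ->
  is_rfield Y -> is_rfield Z ->
  (forall t, cvg_prob P (fun m => U m t) (Y t)) ->
  (forall t, cvg_prob P (fun m => V m t) (Z t)) ->
  (forall m, eq_law P (U m) (V m)) -> eq_law P Y Z.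
Proof.
move=> mU mV mY mZ UY VZ UV; apply: eq_law_half_spaces => // k ts s.
apply/eqP; rewrite eq_le; apply/andP; split.
  exact: (half_spaces_le_cvg_prob ts s mU mV mY mZ UY VZ UV).
apply: (half_spaces_le_cvg_prob ts s mV mU mZ mY VZ UY) => m k' ts' A bA.
by rewrite (UV m _ _ _ bA).
Qed.

(** The images at the points [ts] are one measurable function [h] of the fields at the finitely many
    points [tau (ts l) i]. The pairs [(l, i)] are enumerated by an ordinal because [eq_law] speaks
    of such families. *)
Lemma eq_law_linear P (N n n' : nat) (I : finType) (Q : pred I)
    (C : I -> 'M[R]_(n', n)) (tau : idx N -> I -> idx N)
    (Y Z : @rfield d Omega R N n) :
  eq_law P Y Z ->
  eq_law P (fun t w => \sum_(i | Q i) C i *m Y (tau t i) w)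
           (fun t w => \sum_(i | Q i) C i *m Z (tau t i) w).
Proof.
move=> YZ k ts A bA.
pose J : finType := ('I_k * I)%type.
pose ts' (x : 'I_#|J|) : idx N := tau (ts (enum_val x).1) (enum_val x).2.
pose h (M : 'M[R]_(n, #|J|)) : 'M[R]_(n', k) := \matrix_(a, l)
  \sum_(i | Q i) \sum_c C i a c * M c (enum_rank ((l, i) : J)).
have hE (F : @rfield d Omega R N n) :
    joint (fun t w => \sum_(i | Q i) C i *m F (tau t i) w) ts = h \o joint F ts'.
  apply/funext => w; apply/matrixP => a l; rewrite !mxE summxE.
  apply: eq_bigr => i _; rewrite mxE; apply: eq_bigr => c _.
  by rewrite mxE /ts' enum_rankK.
suff bh : borel_mx (h @^-1` A) by rewrite (hE Y) (hE Z); exact: (YZ _ ts' _ bh).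
have mh : measurable_fun setT (h : g_sigma_algebraType (@mx_cylinder n #|J|) ->
                                    g_sigma_algebraType (@mx_cylinder n' k)).
  apply: (@measurability _ _ _ (g_sigma_algebraType (@mx_cylinder n' k))
    setT _ mx_cylinder) => // _ [_ [a [l [B [mB ->]]]] <-].
  rewrite setTI.
  rewrite (_ : _ @^-1` _ = (fun M : g_sigma_algebraType (@mx_cylinder n #|J|) =>
      \sum_(i | Q i) \sum_c C i a c * M c (enum_rank ((l, i) : J))) @^-1` B); last first.
    by apply/seteqP; split => M /=; rewrite /h mxE.
  rewrite -[_ @^-1` _]setTI.
  under eq_fun do rewrite big_mkcond.
  suff mS : measurable_fun setT (fun M : g_sigma_algebraType (@mx_cylinder n #|J|) =>
      \sum_i if Q i then \sum_c C i a c * M c (enum_rank ((l, i) : J)) else 0).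
    exact: mS.
  apply: measurable_sum => i; case: (Q i); last exact: measurable_cst.
  apply: measurable_sum => c; apply: measurable_funM => //.
  exact: measurable_entry.
have := mh measurableT A bA; rewrite setTI; exact.
Qed.

End Laws.

(** * Solutions of the recursion *)

Section StationaryRepresentation.
Context {d : measure_display} {Omega : measurableType d} {R : realType}
  (P : probability Omega R) {N n : nat} (Th : 'I_N -> 'M[R]_n) (X G : @rfield d Omega R N n).
Context (Th_comm : forall j k, Th j *m Th k = Th k *m Th j).
Context (mX : is_rfield X) (mG : is_rfield G).

Definition exp_field : @rfield d Omega R N n :=
  fun t w => mexp (tstar t Th) *m X t w.

Lemma is_rfield_exp_field : is_rfield exp_field.
Proof. by move=> t; apply: is_rvec_mulmx; exact: mX. Qed.

Lemma exp_fieldK (t : idx N) w : mexp (- tstar t Th) *m exp_field t w = X t w.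
Proof. by rewrite /exp_field mulmxA mexp_tstarK// mul1mx. Qed.

Lemma is_rfield_Delta : is_rfield (Delta G).
Proof. by move=> t; apply: is_rvec_sum => b _; apply: is_rvecZ; exact: mG. Qed.

Lemma is_rvec_psum (t : idx N) M : is_rvec (psum Th G t M).
Proof.
by apply: is_rvec_sum => i _; apply: is_rvec_mulmx; exact: is_rfield_Delta.
Qed.

(* The iterated partial sums of [Delta exp_field] telescope; after the inner
   limits over the coordinates [l >= k], only the corners [b] of the box
   supported on the coordinates [l < k] remain. *)
Definition corner_sum (k : nat) (M : 'I_N -> nat) : @rfield d Omega R N n :=
  fun t w => \sum_(b : {ffun 'I_N -> bool} | [forall l, b l ==> (l < k)%N])
    (-1) ^+ bsize b *: exp_field (jump t M b) w.

Lemma is_rfield_corner_sum k M : is_rfield (corner_sum k M).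
Proof.
by move=> t; apply: is_rvec_sum => b _; apply: is_rvecZ; exact: is_rfield_exp_field.
Qed.

Lemma corner_sum0 M t : corner_sum 0 M t = exp_field t.
Proof.
apply/funext => w; rewrite /corner_sum (big_pred1 [ffun=> false]) => [|b].
  rewrite /bsize big1 => [|l _]; last by rewrite ffunE.
  rewrite scale1r; congr exp_field; apply/funext => l.
  by rewrite /jump ffunE mul0n subr0.
apply/forallP/eqP => [b0|-> l]; last by rewrite ffunE.
by apply/ffunP => l; rewrite ffunE; have := b0 l; rewrite ltn0 implybF => /negbTE.
Qed.

Lemma corner_sumN M t w : corner_sum N M t w =
  \sum_(b : {ffun 'I_N -> bool}) (-1) ^+ bsize b *: exp_field (jump t M b) w.
Proof.
apply: eq_bigl => b; apply/forallP => l; apply/implyP => _; exact: ltn_ord.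
Qed.

(** * Vanishing corners *)

Context (X_vanish : forall (j : 'I_N) (t : idx N),
  cvg_prob P (fun m : nat => fun w =>
    mexp ((- (m%:Z))%:~R *: Th j) *m X (setc t j (- (m%:Z))) w) 0).

(** The exponential splits into the factor of coordinate [j], controlled by the hypothesis, and the
    factor of the other coordinates, constant along the limit. *)
Lemma exp_field_vanish (j : 'I_N) (t : idx N) (c : int) :
  cvg_prob P (fun m => exp_field (setc t j (c - m.+1%:Z))) 0.
Proof.
have E z : exp_field (setc t j z) = fun w => mexp (tstar (setc t j 0) Th) *m
    (mexp (z%:~R *: Th j) *m X (setc t j z) w).
  apply/funext => w; rewrite /exp_field mulmxA; congr (_ *m _).
  rewrite (_ : z%:~R *: Th j = tstar (setc (fun=> 0) j z) Th).
    apply/esym/mexp_tstarD => // l.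
    by rewrite /setc; case: eqP => _; rewrite ?add0r ?addr0.
  rewrite /tstar (bigD1 j)//= big1 ?addr0 /setc ?eqxx// => l /negbTE ->.
  by rewrite scale0r.
have E0 : cvg_prob P (fun m : nat => exp_field (setc t j (- m%:Z))) 0.
  have := @cvg_prob_mulmx _ _ _ P _ _ (mexp (tstar (setc t j 0) Th)) _ _ _ _
    (@X_vanish j t).
  rewrite (_ : (fun _ : Omega => _ *m _) = 0).
    rewrite (_ : (fun _ _ => _) = fun m : nat => exp_field (setc t j (- m%:Z))).
      apply=> [m|]; last exact: is_rvec0.
      by apply: is_rvec_mulmx; exact: mX.
    by apply/funext => m; rewrite E.
  by apply/funext => w; rewrite mulmx0.
(* The hypothesis runs along [- m]; once [m] is at least the absolute value of [c], [- h m] is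
   [c - m.+1]. *)
pose h m : nat := `|m.+1%:Z - c|%N.
have hoo : h @ \oo --> \oo.
  apply/cvgnyPge => A; exists (A + `|c|)%N => // m /= Am; rewrite /h; lia.
apply: cvg_prob_near_eq (cvg_prob_reindex hoo E0).
exists `|c|%N => // m /= cm; congr (exp_field (setc t j _)); rewrite /h; lia.
Qed.

(** Corners with [b k] recede along coordinate [k] and vanish; the others do not involve [m]. *)
Lemma corner_sum_cvg (k : 'I_N) (M : 'I_N -> nat) (t : idx N) :
  cvg_prob P (fun m => corner_sum k.+1 (fun l => if l == k then m else M l) t)
             (corner_sum k M t).
Proof.
pose a (b : {ffun 'I_N -> bool}) : @rvec d Omega R n := if b k then 0 else
  fun w => (-1) ^+ bsize b *: exp_field (jump t M b) w.
rewrite (_ : corner_sum k M t = fun w =>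
    \sum_(b : {ffun 'I_N -> bool} | [forall l, b l ==> (l < k.+1)%N]) a b w).
  apply: cvg_prob_sum => [b m _|b _|b _].
  - by apply: is_rvecZ; exact: is_rfield_exp_field.
  - rewrite /a; case: (b k); first exact: is_rvec0.
    by apply: is_rvecZ; exact: is_rfield_exp_field.
  rewrite /a; case: ifPn => bk.
    pose z := exp_field_vanish k (jump t M b) (t k).
    have := @cvg_prob_mulmx _ _ _ P _ _ ((-1) ^+ bsize b)%:M _ _ _ _ z.
    rewrite (_ : (fun _ : Omega => _ *m _) = 0).
      rewrite (_ : (fun _ _ => _) = fun (m : nat) w => (-1) ^+ bsize b *: exp_field
          (jump t (fun l => if l == k then m else M l) b) w).
        apply=> [m|]; last exact: is_rvec0.
        exact: is_rfield_exp_field.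
      apply/funext => m; apply/funext => w.
      by rewrite mul_scalar_mx (jump_update_in _ _ _ bk).
    by apply/funext => w; rewrite mulmx0.
  rewrite (_ : (fun _ => _) = fun=> (fun w => (-1) ^+ bsize b *: exp_field (jump t M b) w)).
    exact: cvg_prob_cst.
  apply/funext => m; apply/funext => w.
  by rewrite (jump_update_out _ _ _ bk).
apply/funext => w; rewrite [RHS](bigID (fun b : {ffun 'I_N -> bool} => b k)) /=.
rewrite big1 ?add0r => [|b /andP[_ bk]]; last by rewrite /a bk.
apply: eq_big => [b|b /forallP bk].
  apply/forallP/andP => [bk|[/forallP bk nbk] l].
    split; last by have := bk k; rewrite ltnn implybF.
    by apply/forallP => l; apply/implyP => /(implyP (bk l)) /ltnW.
  apply/implyP => bl; have := implyP (bk l) bl; rewrite ltnS leq_eqVlt.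
  case/orP => [/eqP/val_inj lk|//]; by rewrite -lk bl in nbk.
by rewrite /a; have := bk k; rewrite ltnn implybF => /negbTE ->.
Qed.

(** * The recursion and the value of the iterated limit *)

Context (X_rec : forall t : idx N, {ae P, forall w,
     X t w = \sum_(i : {ffun 'I_N -> bool} | i != [ffun => false])
               (-1) ^+ (bsize i).+1 *: (mexp (- tstar (boolidx i) Th)
                                         *m X (subi t i) w)
             + Delta G t w}).

(** The product of exp(t * Th) and exp(- i * Th) is the exponential at the corner [subi t i];
    bringing the sum to the left side absorbs the extra sign of the recursion. *)
Lemma Delta_exp_field (t : idx N) :
  {ae P, forall w, Delta exp_field t w = mexp (tstar t Th) *m Delta G t w}.
Proof.
apply: filterS (X_rec t) => w Xt; rewrite /Delta -/(Delta G t w).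
have -> : Delta G t w = X t w -
    \sum_(i : {ffun 'I_N -> bool} | i != [ffun => false])
      (-1) ^+ (bsize i).+1 *: (mexp (- tstar (boolidx i) Th) *m X (subi t i) w).
  by rewrite {1}Xt addrC addKr.
rewrite (bigD1 [ffun=> false])//= mulmxBr; congr (_ + _).
  rewrite /bsize big1 => [|l _]; last by rewrite ffunE.
  have -> : subi t [ffun=> false] = t by apply/funext => l; rewrite /subi ffunE subr0.
  by rewrite scale1r.
rewrite mulmx_sumr -sumrN; apply: eq_bigr => b _.
rewrite exprS mulN1r scaleNr mulmxN opprK -scalemxAr; congr (_ *: _).
by rewrite mulmxA -tstarN (@mexp_tstarD _ _ _ _ _ _ _ (subi t b)).
Qed.

(** The lattice is countable, so the null sets can be united; the enumeration goes through finite
    functions. *)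
Lemma ae_forall_idx (Q : idx N -> Omega -> Prop) :
  (forall t, {ae P, forall w, Q t w}) -> {ae P, forall w, forall t, Q t w}.
Proof.
move=> aeQ.
have : {ae P, forall w, forall m : nat,
    if unpickle m is Some f then Q (fun l => (f : {ffun 'I_N -> int}) l) w else True}.
  apply: ae_foralln => m; case: unpickle => [f|]; first exact: aeQ.
  exact: aeW.
apply: filterS => w Qw t; have := Qw (pickle (finfun t)); rewrite pickleK.
by congr (Q _ w); apply/funext => l; rewrite ffunE.
Qed.

Lemma psum_corner_sum (t : idx N) (M : 'I_N -> nat) :
  {ae P, forall w, psum Th G t M w = corner_sum N M t w}.
Proof.
apply: filterS (ae_forall_idx Delta_exp_field) => w H.
rewrite corner_sumN -(box_sum_Delta (fun s => exp_field s w)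
  (K := \max_(l < N) M l)) => [|l]; last exact: leq_bigmax.
by apply: eq_bigr => i _; rewrite -H.
Qed.

(** Downward induction on the level [N - j]: almost sure uniqueness of the limit identifies each
    intermediate random vector with the corner sum of that level. *)
Lemma iter_cvg_prob_psum (t : idx N) (L : rvec n) :
  iter_cvg_prob P (psum Th G t) L -> {ae P, forall w, L w = exp_field t w}.
Proof.
move=> [Gs [GsN mGs Gs_cvg ->]].
suff H j M : (j <= N)%N -> {ae P, forall w, Gs (N - j)%N M w = corner_sum (N - j) M t w}.
  by have := H N (fun=> 0%N) (leqnn N); rewrite subnn corner_sum0.
elim: j M => [|j IH] M jN; first by rewrite subn0 GsN; exact: psum_corner_sum.
have kN : (N - j.+1 < N)%N by rewrite ltn_subrL (leq_ltn_trans _ jN).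
have Gc := Gs_cvg (Ordinal kN) M; have Wc := corner_sum_cvg (Ordinal kN) M t.
rewrite /= subnSK// in Gc Wc.
apply: (cvg_prob_unique _ _ _ Gc).
- by move=> m; exact: mGs.
- exact: mGs.
- exact: is_rfield_corner_sum.
apply: cvg_prob_ae Wc.
- by move=> m; exact: is_rfield_corner_sum.
- by move=> m; exact: mGs.
- exact: is_rfield_corner_sum.
- exact: is_rfield_corner_sum.
- by move=> m; have := IH (fun l => if l == Ordinal kN then m else M l) (ltnW jN);
    apply: filterS => w ->.
- exact: aeW.
Qed.

(** * Stationarity *)

Context (G_stat : stat_incr P G).

(** It interpolates between the damped partial sum, almost surely at level [N], and [X] itself at
    level 0. *)
Definition damped_corner_sum k M : @rfield d Omega R N n :=
  fun t w => mexp (- tstar t Th) *m corner_sum k M t w.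

Lemma is_rfield_damped_corner_sum k M : is_rfield (damped_corner_sum k M).
Proof. by move=> t; apply: is_rvec_mulmx; exact: is_rfield_corner_sum. Qed.

Lemma is_rfield_shift (Y : @rfield d Omega R N n) s : is_rfield Y -> is_rfield (Defs.shift Y s).
Proof. by move=> mY t; exact: mY. Qed.

(** The damping cancels [t] in the weights and leaves [C i], which depends on the offset only; hence
    the operator [S] commutes with shifts. *)
Lemma stationary_psum (M : 'I_N -> nat) :
  stationary P (fun t w => mexp (- tstar t Th) *m psum Th G t M w).
Proof.
move=> s; pose I := {ffun 'I_N -> 'I_(\max_(l < N) M l).+1}.
pose Q (i : I) := [forall l, (i l <= M l)%N].
pose tau t (i : I) := back t (fun l => i l).
pose C (i : I) := mexp (- tstar (fun l => (i l)%:Z) Th).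
pose S (Y : @rfield d Omega R N n) : @rfield d Omega R N n :=
  fun t w => \sum_(i : I | Q i) C i *m Y (tau t i) w.
have SE : (fun t w => mexp (- tstar t Th) *m psum Th G t M w) = S (Delta G).
  apply/funext => t; apply/funext => w; rewrite mulmx_sumr; apply: eq_bigr => i _.
  rewrite mulmxA -!tstarN; congr (_ *m _); rewrite /C -tstarN.
  by apply: mexp_tstarD => // l; rewrite addrA addNr add0r.
have shiftE : Defs.shift (S (Delta G)) s = S (Defs.shift (Delta G) s).
  apply/funext => t; apply/funext => w; rewrite /S /Defs.shift; apply: eq_bigr => i _.
  have -> // : tau (fun l => t l + s l) i = fun l => tau t i l + s l.
  by apply/funext => l; rewrite /tau /back addrAC.
by rewrite SE shiftE; exact: eq_law_linear.
Qed.

Lemma stationary_damped_corner_sum j M : (j <= N)%N ->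
  stationary P (damped_corner_sum (N - j) M).
Proof.
elim: j M => [|j IH] M jN s.
  have mS : is_rfield (fun t w => mexp (- tstar t Th) *m psum Th G t M w).
    by move=> t; apply: is_rvec_mulmx; exact: is_rvec_psum.
  have mW := is_rfield_damped_corner_sum (N - 0) M.
  (* The partial sum and the corner sum agree almost surely only. Viewing the former as a constant
     sequence converging to the latter transfers the law by [eq_law_cvg_prob]. *)
  have cvgS t : cvg_prob P (fun=> (fun w => mexp (- tstar t Th) *m psum Th G t M w))
      (damped_corner_sum (N - 0) M t).
    apply: cvg_prob_ae (cvg_prob_cst P (damped_corner_sum (N - 0) M t)).
    - by move=> _; exact: mW.
    - by move=> _; exact: mS.
    - exact: mW.
    - exact: mW.
    - by move=> _; rewrite subn0; apply: filterS (psum_corner_sum t M) => w;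
        rewrite /damped_corner_sum => ->.
    - exact: aeW.
  pose S : @rfield d Omega R N n := fun t w => mexp (- tstar t Th) *m psum Th G t M w.
  apply: (@eq_law_cvg_prob _ _ _ P N n (fun=> Defs.shift S s) (fun=> S)).
  - by move=> _; exact: is_rfield_shift mS.
  - by move=> _; exact: mS.
  - exact: is_rfield_shift mW.
  - exact: mW.
  - by move=> t; exact: cvgS.
  - exact: cvgS.
  - by move=> _; exact: stationary_psum.
have kN : (N - j.+1 < N)%N by rewrite ltn_subrL (leq_ltn_trans _ jN).
pose Mm m l := if l == Ordinal kN then m else M l.
have cvgW t : cvg_prob P (fun m => damped_corner_sum (N - j) (Mm m) t)
    (damped_corner_sum (N - j.+1) M t).
  apply: cvg_prob_mulmx.
  - by move=> m; exact: is_rfield_corner_sum.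
  - exact: is_rfield_corner_sum.
  - by have := corner_sum_cvg (Ordinal kN) M t; rewrite /= subnSK.
apply: (@eq_law_cvg_prob _ _ _ P N n
  (fun m => Defs.shift (damped_corner_sum (N - j) (Mm m)) s)
  (fun m => damped_corner_sum (N - j) (Mm m))).
- by move=> m; apply: is_rfield_shift; exact: is_rfield_damped_corner_sum.
- by move=> m; exact: is_rfield_damped_corner_sum.
- by apply: is_rfield_shift; exact: is_rfield_damped_corner_sum.
- exact: is_rfield_damped_corner_sum.
- by move=> t; exact: cvgW.
- exact: cvgW.
- by move=> m; apply: IH; exact: ltnW.
Qed.

Lemma stationary_solution : stationary P X.
Proof.
have := stationary_damped_corner_sum (fun=> 0%N) (leqnn N); rewrite subnn.
rewrite (_ : damped_corner_sum 0 _ = X)//.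
apply/funext => t; apply/funext => w.
by rewrite /damped_corner_sum corner_sum0 exp_fieldK.
Qed.

End StationaryRepresentation.

Theorem mainTheorem10 (d : measure_display) (Omega : measurableType d)
  (R : realType) (P : probability Omega R) (N n : nat)
  (Th : 'I_N -> 'M[R]_n) (X : rfield N n) (G : rfield N n) :
  (forall j, symmetric_pd (Th j)) ->
  (forall j k, Th j *m Th k = Th k *m Th j) ->
  is_rfield X ->
  (forall (j : 'I_N) (t : idx N),
     cvg_prob P (fun m : nat => fun w =>
        mexp ((- (m%:Z))%:~R *: Th j) *m X (setc t j (- (m%:Z))) w) 0) ->
  GTheta P Th G ->
  (forall t : idx N, {ae P, forall w,
     X t w = \sum_(i : {ffun 'I_N -> bool} | i != [ffun => false])
               (-1) ^+ (bsize i).+1 *: (mexp (- tstar (boolidx i) Th)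
                                         *m X (subi t i) w)
             + Delta G t w}) ->
  stationary P X /\
  forall (t : idx N) (L : rvec n), iter_cvg_prob P (psum Th G t) L ->
    {ae P, forall w, X t w = mexp (- tstar t Th) *m L w}.
Proof.
move=> _ Th_comm mX X_vanish [mG [G_stat _]] X_rec; split.
  exact: (stationary_solution Th_comm mX mG X_vanish X_rec G_stat).
move=> t L /(iter_cvg_prob_psum Th_comm mX X_vanish X_rec).
by apply: filterS => w ->; rewrite exp_fieldK.
Qed.
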